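(* Let $X$ be a real Hilbert space, let $\gamma<0$, let $x_0,y_0\in X$, and let $C_\gamma=\{(x,y)\in X\times X : \langle x,y\rangle=\gamma\}$. Then the following hold. (i) When $x_0\neq y_0$ and $x_0\neq -y_0$, the projection is a singleton: $$P_{C_\gamma}(x_0,y_0)=\left\{\left(\frac{x_0+\lambda y_0}{1-\lambda^2},\ \frac{y_0+\lambda x_0}{1-\lambda^2}\right)\right\},$$ where $\lambda$ is the unique solution of $H(\lambda)=0$ in the open interval $(-1,1)$, with $$H(\lambda)=\frac{(\lambda^2+1)p-2\lambda q}{2(1-\lambda^2)^2}+\gamma,\qquad p=-2\langle x_0,y_0\rangle,\qquad q=\|x_0\|^2+\|y_0\|^2.$$ (ii) When $x_0=y_0$, the projection is the set $$P_{C_\gamma}(x_0,x_0)=\left\{\left(\frac{x_0}{2}+\frac{\tilde u}{\sqrt2},\ \frac{x_0}{2}-\frac{\tilde u}{\sqrt2}\right) : \tilde u\in X,\ \|\tilde u\|^2=-2\gamma+\frac{\|x_0\|^2}{2}\right\}.$$ (iii) a) When $x_0=-y_0$ and $\|x_0\|\ge 2\sqrt{-\gamma}$, the projection is the set $$P_{C_\gamma}(x_0,-x_0)=\left\{\left(\frac{x_0}{2}-\frac{\tilde v}{\sqrt2},\ \frac{-x_0}{2}-\frac{\tilde v}{\sqrt2}\right) : \tilde v\in X,\ \|\tilde v\|^2=\frac{\|x_0\|^2}{2}+2\gamma\right\}.$$ b) When $x_0=-y_0$ and $0<\|x_0\|<2\sqrt{-\gamma}$, the projection is the singleton $$P_{C_\gamma}(x_0,-x_0)=\left\{\sqrt{-\gamma}\left(\frac{x_0}{\|x_0\|},\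 \frac{-x_0}{\|x_0\|}\right)\right\}.$$
   Context: $X$ is a real Hilbert space with inner product $\langle\cdot,\cdot\rangle$ and induced norm $\|\cdot\|$. The product $X\times X$ carries the norm $\|(x,y)\|^2=\|x\|^2+\|y\|^2$. For a set $S\subseteq X\times X$ and a point $z\in X\times X$, $P_S(z)$ denotes the (possibly empty, possibly multi-valued) set of nearest points: $P_S(z)=\{s\in S : \|z-s\|\le\|z-s'\|\text{ for all }s'\in S\}$. *)

(* Defs.v *)
From mathcomp Require Import all_boot all_order all_algebra.
From mathcomp Require Import all_classical all_reals all_analysis.

Set Implicit Arguments.
Unset Strict Implicit.
Unset Printing Implicit Defensive.

Import Order.TTheory GRing.Theory Num.Theory.
Import numFieldNormedType.Exports.

Local Open Scope classical_set_scope.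
Local Open Scope ring_scope.

(* A real Hilbert space is a [completeNormedModType R], [R : realType], whose
   norm is induced by a positive definite symmetric form [dot]. *)
Definition induces_norm (R : realType) (X : completeNormedModType R)
    (dot : {dot X for idfun}) : Prop :=
  forall x : X, `|x| = Num.sqrt (dot x x).

(* Not the library's norm on [X * X], which is the maximum of the norms of the
   two components. *)
Definition norm2 (R : realType) (X : completeNormedModType R)
    (z : X * X) : R :=
  Num.sqrt (`|z.1| ^+ 2 + `|z.2| ^+ 2).

Definition projset (R : realType) (X : completeNormedModType R)
    (S : set (X * X)) (z : X * X) : set (X * X) :=
  [set s | S s /\ forall s', S s' -> norm2 (z - s) <= norm2 (z - s')].

Definition Cset (R : realType) (X : completeNormedModType R)
    (dot : {dot X for idfun}) (gamma : R) : set (X * X) :=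
  [set z | dot z.1 z.2 = gamma].

Definition Hfun (R : realType) (p q gamma lambda : R) : R :=
  ((lambda ^+ 2 + 1) * p - 2 * lambda * q) / (2 * (1 - lambda ^+ 2) ^+ 2)
  + gamma.

(* Main.v *)
Require Import Defs.
From mathcomp Require Import all_boot all_order all_algebra.
From mathcomp Require Import all_classical all_reals all_analysis.
From mathcomp Require Import ring lra.

Import Order.TTheory GRing.Theory Num.Theory.
Import numFieldNormedType.Exports.

Local Open Scope classical_set_scope.
Local Open Scope ring_scope.

(** Fix [l] in [[-1, 1]] and a point [(a, b)] of the surface
    [C = {<x, y> = gamma}].  Seen from the point [(a - l b, b - l a)], for which
    [(a, b)] is a Lagrange critical point of the squared distance with
    multiplier [l], the squared distance to any [(x, y)] of [C] exceeds the
    squared distance to [(a, b)] by exactly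
      [gap l (x - a) (y - b) = |x - a|^2 + |y - b|^2 - 2 l <x - a, y - b>],
    because the first-order terms of the squared distance cancel against the
    equation [<x, y> = <a, b>].  This quadratic form is nonnegative for
    [|l| <= 1], so critical points with such a multiplier are global minimizers
    and the nearest points are the zeros of the gap in [C]
    ([projset_stationary]).

    For [|l| < 1] the form is definite and the nearest point is unique.  Solving
    [(x0, y0) = (a - l b, b - l a)] for [a] and [b] gives the point of (i), and
    it lies on [C] exactly when [Hfun] vanishes at [l].  A root exists by the
    intermediate value theorem applied to a polynomial numerator of [Hfun]
    ([Hfun_root]), and uniqueness of the root is read off from uniqueness of the
    nearest point ([Hfun_root_unique]).  Case (iii) b) is the same argument with
    [l = |x0| / sqrt (- gamma) - 1].

    For [l = - e] with [e] equal to [1] or [- 1] the gap is the square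
    [|(x - a) + e (y - b)|^2], so the nearest points are the points of [C] with
    [x + e y = x0].  In the coordinate [x - e y] this affine subspace meets [C]
    in a sphere, possibly of radius zero; this gives (ii) and (iii) a) together
    ([projset_diag]). *)

(** * Inner product *)

Section RealHilbert.
Set Implicit Arguments.
Unset Strict Implicit.
Unset Printing Implicit Defensive.

Context {R : realType} {X : completeNormedModType R}.
Context (dot : {dot X for idfun}) (dot_norm : induces_norm dot).
Implicit Types (x y z a b u v : X) (g l e : R).

Lemma dotC x y : dot x y = dot y x.
Proof. by rewrite hermC expr0 mul1r. Qed.

Lemma dotDl x y z : dot (x + y) z = dot x z + dot y z.
Proof. exact: linearDl. Qed.

Lemma dotDr x y z : dot z (x + y) = dot z x + dot z y.
Proof. exact: linearDr. Qed.

Lemma dotNl x z : dot (- x) z = - dot x z.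
Proof. exact: linearNl. Qed.

Lemma dotNr x z : dot z (- x) = - dot z x.
Proof. exact: linearNr. Qed.

Lemma dotZl c x z : dot (c *: x) z = c * dot x z.
Proof. exact: linearZl_LR. Qed.

Lemma dotZr c x z : dot z (c *: x) = c * dot z x.
Proof. exact: linearZr_LR. Qed.

Lemma dot0l z : dot 0 z = 0.
Proof. exact: linear0l. Qed.

Definition dotE := (dotDl, dotDr, dotNl, dotNr, dotZl, dotZr).

Lemma dotxx_eq0 x : (dot x x == 0) = (x == 0).
Proof.
apply/idP/idP => [|/eqP->]; last by rewrite dot0l.
by apply: contraTT => /neq0_dnorm_gt0 /gt_eqF ->.
Qed.

Lemma dotxx_ge0 x : 0 <= dot x x.
Proof.
have [->|/neq0_dnorm_gt0 /ltW //] := eqVneq x 0.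
by rewrite dot0l.
Qed.

Lemma dot_sub_eq0 x y : dot (x - y) (x - y) = 0 -> x = y.
Proof. by move/eqP; rewrite dotxx_eq0 subr_eq0 => /eqP. Qed.

(** * The gap form *)

(** The Hessian of the Lagrangian
    [|x - x0|^2 + |y - y0|^2 - 2 l (<x, y> - gamma)], up to a factor [2]. *)
Definition gap l x y := dot x x + dot y y - 2 * l * dot x y.

Lemma gap0 l : gap l 0 0 = 0.
Proof. by rewrite /gap !dot0l mulr0 subr0 addr0. Qed.

(** Completing the square: nonnegativity for [|l| <= 1], definiteness for
    [|l| < 1] and degeneracy at [l = 1] and [l = -1] all show here. *)
Lemma gap_square l x y :
  gap l x y = dot (x - l *: y) (x - l *: y) + (1 - l ^+ 2) * dot y y.
Proof. by rewrite /gap !dotE (dotC y x); ring. Qed.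

Lemma gap_ge0 l x y : -1 <= l <= 1 -> 0 <= gap l x y.
Proof.
move=> lb; rewrite gap_square addr_ge0 ?dotxx_ge0 ?mulr_ge0 ?dotxx_ge0 //.
by nra.
Qed.

Lemma gap_eq0 l x y : -1 < l < 1 -> gap l x y = 0 -> x = 0 /\ y = 0.
Proof.
move=> lb; rewrite gap_square => /eqP.
have l2 : 0 < 1 - l ^+ 2 by nra.
rewrite paddr_eq0 ?dotxx_ge0 ?mulr_ge0 ?dotxx_ge0 ?(ltW l2) //.
rewrite mulf_eq0 (gt_eqF l2) /= !dotxx_eq0 => /andP[/eqP + /eqP y0].
by rewrite y0 scaler0 subr0.
Qed.

(** * Nearest points on the surface *)

Lemma sqr_norm x : `|x| ^+ 2 = dot x x.
Proof. by rewrite dot_norm sqr_sqrtr ?dotxx_ge0. Qed.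

Lemma ler_norm2 (z z' : X * X) :
  (norm2 z <= norm2 z')
  = (dot z.1 z.1 + dot z.2 z.2 <= dot z'.1 z'.1 + dot z'.2 z'.2).
Proof.
by rewrite /norm2 !sqr_norm ler_sqrt // addr_ge0 ?dotxx_ge0.
Qed.

(** The squared distance from [(a - l b, b - l a)] to a point [(x, y)] of the
    surface is the constant [l^2 (|a|^2 + |b|^2)] plus the gap, which is
    nonnegative and vanishes at [(a, b)]. *)
Lemma projset_stationary g l a b : -1 <= l <= 1 -> dot a b = g ->
  projset (Cset dot g) (a - l *: b, b - l *: a)
  = [set z | Cset dot g z /\ gap l (z.1 - a) (z.2 - b) = 0].
Proof.
move=> lb abg.
have excess (x y : X) : dot x y = g ->
    dot (a - l *: b - x) (a - l *: b - x) + dot (b - l *: a - y) (b - l *: a - y)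
    = l ^+ 2 * (dot a a + dot b b) + gap l (x - a) (y - b).
  move=> xyg; rewrite /gap !dotE.
  rewrite (dotC b a) (dotC x a) (dotC x b) (dotC y a) (dotC y b).
  by rewrite abg xyg; ring.
have excess_ab := excess a b abg.
rewrite !subrr gap0 addr0 in excess_ab.
apply/seteqP; split=> [[x y] [xyg /=]|[x y] [xyg /= gapxy]].
  move=> /(_ (a, b) abg); rewrite ler_norm2 /= excess_ab excess // gerDl => le0.
  by split=> //; apply/eqP; rewrite eq_le le0 gap_ge0.
split=> // -[x' y'] Cz'.
by rewrite ler_norm2 /= !excess // gapxy lerD2l gap_ge0.
Qed.

Lemma projset_stationary_unique g l a b : -1 < l < 1 -> dot a b = g ->
  projset (Cset dot g) (a - l *: b, b - l *: a) = [set (a, b)].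
Proof.
move=> lb abg; rewrite projset_stationary //; last by lra.
apply/seteqP; split=> [[x y] [_ /= /(gap_eq0 lb)[]]|z ->].
  by move=> /subr0_eq -> /subr0_eq ->.
by split=> //=; rewrite !subrr gap0.
Qed.

(** The multiplier is [- e], for which the gap only sees [x + e y].  The points
    [pt u] parametrize the line condition [x + e y = x0], and lie on the surface
    exactly for [u] on the sphere.  Each [pt u] serves as the critical
    point of [projset_stationary], so the only issue is whether the sphere is
    nonempty: it may be empty, but only if the space is trivial, in which case
    the surface has no point since [g] is nonzero. *)
Lemma projset_diag g e (x0 : X) : g != 0 -> e ^+ 2 = 1 ->
  0 <= `|x0| ^+ 2 / 2 - 2 * e * g ->
  projset (Cset dot g) (x0, e *: x0) =
    [set (2^-1 *: x0 + e *: ((Num.sqrt 2)^-1 *: u),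
          2^-1 *: (e *: x0) - (Num.sqrt 2)^-1 *: u)
    | u in [set u : X | `|u| ^+ 2 = `|x0| ^+ 2 / 2 - 2 * e * g]].
Proof.
move=> g0 e2 r0; set s := (Num.sqrt 2)^-1.
have s2 : s ^+ 2 = 2^-1 by rewrite exprVn sqr_sqrtr.
have eb : -1 <= - e <= 1.
  by move/eqP: e2; rewrite sqrf_eq1 => /orP[] /eqP ->; lra.
pose pt (u : X) := (2^-1 *: x0 + e *: (s *: u), 2^-1 *: (e *: x0) - s *: u).
have gap_line (x y : X) : gap (- e) x y = dot (x + e *: y) (x + e *: y).
  by rewrite gap_square sqrrN e2 subrr mul0r addr0 scaleNr opprK.
have pt_sum (u : X) : (pt u).1 + e *: (pt u).2 = x0.
  apply: dot_sub_eq0; rewrite /= !dotE (dotC u x0).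
  set A := dot x0 x0; set B := dot x0 u; set C := dot u u.
  (* Grouped so that [e ^+ 2 = 1] applies by rewriting. *)
  transitivity ((1 - e ^+ 2) ^+ 2 * (A / 4)); first by field.
  by rewrite e2 subrr expr0n mul0r.
have pt_Cset (u : X) : `|u| ^+ 2 = `|x0| ^+ 2 / 2 - 2 * e * g -> Cset dot g (pt u).
  rewrite !sqr_norm /Cset /= => uu; rewrite !dotE (dotC u x0) uu.
  transitivity (e * dot x0 x0 * (4^-1 - s ^+ 2 / 2)
    + (e ^+ 2 - 1) * s / 2 * dot x0 u + s ^+ 2 * e ^+ 2 * 2 * g); first by field.
  by rewrite s2 e2; field.
have pt_proj (u : X) : `|u| ^+ 2 = `|x0| ^+ 2 / 2 - 2 * e * g ->
    projset (Cset dot g) (x0, e *: x0)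
    = [set z | Cset dot g z /\ z.1 + e *: z.2 = x0].
  move=> uu; have -> : (x0, e *: x0)
      = ((pt u).1 - - e *: (pt u).2, (pt u).2 - - e *: (pt u).1).
    rewrite !scaleNr !opprK pt_sum; congr pair.
    by rewrite -(pt_sum u) scalerDr scalerA -expr2 e2 scale1r addrC.
  rewrite projset_stationary //; last exact: pt_Cset.
  have split_sum (z : X * X) : (z.1 - (pt u).1) + e *: (z.2 - (pt u).2)
      = (z.1 + e *: z.2) - x0.
    by rewrite scalerBr addrACA -opprD pt_sum.
  apply/seteqP; split=> z [Cz /=]; rewrite gap_line split_sum.
    by move/dot_sub_eq0.
  by move=> ->; rewrite subrr dot0l.
apply/seteqP; split=> [z Pz|_ [u uu <-]]; last first.
  by rewrite (pt_proj u uu); split; [exact: pt_Cset|exact: pt_sum].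
have Cz : Cset dot g z by case: Pz.
have z1_neq0 : `|z.1| != 0.
  rewrite normr_eq0; apply: contraNneq g0 => z10.
  by rewrite -Cz z10 dot0l.
(* A nonzero direction is available from [z] itself; rescaling it gives a
   point of the sphere. *)
move: Pz; rewrite (pt_proj ((Num.sqrt (`|x0| ^+ 2 / 2 - 2 * e * g) / `|z.1|) *: z.1)).
  move=> [_ zx0].
  exists (s *: (e *: z.1 - z.2)).
    rewrite /= !sqr_norm -zx0 !dotE (dotC z.2 z.1) (Cz : dot z.1 z.2 = g).
    transitivity (s ^+ 2 * (e ^+ 2 * dot z.1 z.1 - 2 * e * g + dot z.2 z.2)).
      by field.
    transitivity (2^-1 * (dot z.1 z.1 - 2 * e * g + e ^+ 2 * dot z.2 z.2)).
      by rewrite s2 e2; ring.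
    by field.
  (* Vector identities are checked by showing that the difference has zero
     square, an identity of scalars; the coefficients of the expansion are
     grouped so that [s ^+ 2 = 1 / 2] and [e ^+ 2 = 1] kill each of them. *)
  rewrite -zx0; case: z {Cz z1_neq0 zx0} => x y /=; congr pair; apply: dot_sub_eq0.
    rewrite !dotE (dotC y x).
    move: (dot x x) (dot x y) (dot y y) => A B C.
    transitivity ((s ^+ 2 * e ^+ 2 - 2^-1) ^+ 2 * A
      + 2 * (s ^+ 2 * e ^+ 2 - 2^-1) * (2^-1 - s ^+ 2) * e * B
      + (2^-1 - s ^+ 2) ^+ 2 * e ^+ 2 * C); first by field.
    by rewrite s2 e2; field.
  rewrite !dotE (dotC y x).
  move: (dot x x) (dot x y) (dot y y) => A B C.
  transitivity ((2^-1 - s ^+ 2) ^+ 2 * e ^+ 2 * A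
    + 2 * (2^-1 - s ^+ 2) * e * (e ^+ 2 / 2 + s ^+ 2 - 1) * B
    + (e ^+ 2 / 2 + s ^+ 2 - 1) ^+ 2 * C); first by field.
  by rewrite s2 e2; field.
by rewrite normrZ ger0_norm ?divr_ge0 ?sqrtr_ge0 // divfK // sqr_sqrtr.
Qed.

(** In the coordinates [x0 + y0] and [x0 - y0], of squared norms [A] and [B],
    the numerator of [- Hfun] is, up to a factor, the polynomial
    [A (1 + t)^2 - B (1 - t)^2 - 4 g (1 - t^2)^2].  Its values at [-1] and [1]
    are [- 4 B] and [4 A], hence nonzero of opposite signs. *)
Lemma Hfun_root g (x0 y0 : X) : x0 <> y0 -> x0 <> - y0 ->
  exists2 l, -1 < l < 1 & Hfun (- 2 * dot x0 y0) (`|x0| ^+ 2 + `|y0| ^+ 2) g l = 0.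
Proof.
move=> xy xNy.
have Hfun_num l : -1 < l < 1 ->
    Hfun (- 2 * dot x0 y0) (`|x0| ^+ 2 + `|y0| ^+ 2) g l =
    (dot (x0 - y0) (x0 - y0) * (1 - l) ^+ 2
     - dot (x0 + y0) (x0 + y0) * (1 + l) ^+ 2
     + 4 * g * (1 - l ^+ 2) ^+ 2) / (4 * (1 - l ^+ 2) ^+ 2).
  move=> lb; have l2 : 1 - l ^+ 2 != 0 by apply/eqP; nra.
  by rewrite /Hfun !sqr_norm !dotE (dotC y0 x0); field.
have A0 : 0 < dot (x0 + y0) (x0 + y0).
  by apply: neq0_dnorm_gt0; rewrite addr_eq0; apply/eqP.
have B0 : 0 < dot (x0 - y0) (x0 - y0).
  by apply: neq0_dnorm_gt0; rewrite subr_eq0; apply/eqP.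
move: (dot (x0 + y0) _) (dot (x0 - y0) _) A0 B0 Hfun_num => A B A0 B0 Hfun_num.
pose P : {poly R} := A *: (1 + 'X) ^+ 2 - B *: (1 - 'X) ^+ 2
  - (4 * g) *: (1 - 'X ^+ 2) ^+ 2.
have hP t : P.[t] = A * (1 + t) ^+ 2 - B * (1 - t) ^+ 2
    - 4 * g * (1 - t ^+ 2) ^+ 2 by rewrite /P !hornerE.
have PN1 : P.[-1] = - (4 * B) by rewrite hP; ring.
have P1 : P.[1] = 4 * A by rewrite hP; ring.
have [||l lb /rootP Pl] := @poly_ivt R P (-1) 1; first by lra.
  by rewrite PN1 P1; lra.
have l1 : -1 < l < 1.
  rewrite !lt_neqAle andbACA lb andbT.
  apply/andP; split.
    by apply: contraPneq Pl => <-; rewrite PN1; lra.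
  by apply: contraPneq Pl => ->; rewrite P1; lra.
rewrite hP in Pl.
exists l => //; rewrite Hfun_num //.
by rewrite (_ : _ + _ = 0) ?mul0r //; lra.
Qed.

(** The antisymmetric point [(a, - a)] with [a] along [x0] and of norm
    [sqrt (- g)] is critical for the multiplier [|x0| / sqrt (- g) - 1]; the
    bounds on [|x0|] say precisely that this lies in [(-1, 1)]. *)
Lemma projset_opp_near g (x0 : X) : 0 < `|x0| < 2 * Num.sqrt (- g) ->
  projset (Cset dot g) (x0, - x0) =
   [set Num.sqrt (- g) *: (`|x0|^-1 *: x0, `|x0|^-1 *: (- x0))].
Proof.
case/andP => x0_gt0 x0_lt.
have r0 : 0 < Num.sqrt (- g) by lra.
have rg : Num.sqrt (- g) ^+ 2 = - g by rewrite sqr_sqrtr // ltW // -sqrtr_gt0.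
move: (Num.sqrt _) r0 rg x0_lt => r r0 rg x0_lt.
set l := `|x0| / r - 1.
have lb : -1 < l < 1.
  by rewrite ltrBrDr addNr divr_gt0 //= ltrBlDr ltr_pdivrMr.
have coef : r / `|x0| + l * (r / `|x0|) = 1.
  by rewrite /l; field; rewrite !gt_eqF.
rewrite -[RHS]/[set (r *: (`|x0|^-1 *: x0), r *: (`|x0|^-1 *: (- x0)))].
rewrite -(@projset_stationary_unique g l) //; last first.
  rewrite !dotE -sqr_norm; transitivity (- r ^+ 2); last by rewrite rg opprK.
  by field; rewrite gt_eqF.
have invert (x : X) :
    r *: (`|x0|^-1 *: x) - l *: (r *: (`|x0|^-1 *: (- x))) = x.
  by rewrite !scalerN opprK !scalerA -?mulrA -scalerDl coef scale1r.
have invertN := invert (- x0); rewrite opprK in invertN.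
by rewrite invert invertN.
Qed.

(** The displayed point is the solution of the linear system
    [a - l b = x0], [b - l a = y0], and [Hfun] at [l] equals [g - <a, b>]. *)
Lemma projset_Hfun_root g (x0 y0 : X) l : -1 < l < 1 ->
  Hfun (- 2 * dot x0 y0) (`|x0| ^+ 2 + `|y0| ^+ 2) g l = 0 ->
  projset (Cset dot g) (x0, y0) =
    [set ((1 - l ^+ 2)^-1 *: (x0 + l *: y0), (1 - l ^+ 2)^-1 *: (y0 + l *: x0))].
Proof.
move=> lb Hl; set k := (1 - l ^+ 2)^-1.
have l2 : 1 - l ^+ 2 != 0 by apply/eqP; nra.
rewrite -(@projset_stationary_unique g l) //; last first.
  rewrite -[RHS]subr0 -Hl /Hfun !sqr_norm !dotE (dotC y0 x0).
  by rewrite /k; field.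
have invert (x y : X) : k *: (x + l *: y) - l *: (k *: (y + l *: x)) = x.
  rewrite !(scalerDr, scalerA) opprD (addrC (- _)) addrACA -!scalerBl.
  rewrite (_ : k - _ = 1); last by rewrite /k; field.
  by rewrite (_ : k * l - _ = 0) ?scale1r ?scale0r ?addr0 //; rewrite mulrC subrr.
by rewrite !invert.
Qed.

(** If two parameters satisfied the equation, they would give the same nearest
    point; the sum of its two components is [(1 - l)^-1 *: (x0 + y0)], and
    this determines [l] as soon as [x0 + y0] is nonzero. *)
Lemma Hfun_root_unique g (x0 y0 : X) l l' : x0 <> - y0 ->
  -1 < l < 1 -> Hfun (- 2 * dot x0 y0) (`|x0| ^+ 2 + `|y0| ^+ 2) g l = 0 ->
  -1 < l' < 1 -> Hfun (- 2 * dot x0 y0) (`|x0| ^+ 2 + `|y0| ^+ 2) g l' = 0 ->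
  l = l'.
Proof.
move=> xNy lb Hl lb' Hl'.
have := projset_Hfun_root lb' Hl'.
rewrite (projset_Hfun_root lb Hl) => /seteqP[].
move=> /(_ _ erefl) /= [ea eb] _.
have sum_pt t : -1 < t < 1 -> (1 - t ^+ 2)^-1 *: (x0 + t *: y0)
    + (1 - t ^+ 2)^-1 *: (y0 + t *: x0) = (1 - t)^-1 *: (x0 + y0).
  move=> tb; rewrite -scalerDr [y0 + _]addrC addrACA -{1}[x0]scale1r.
  rewrite -{2}[y0]scale1r -!scalerDl [t + 1]addrC -scalerDr scalerA.
  by congr (_ *: _); field; apply/andP; split; apply/eqP; nra.
have := sum_pt l lb; rewrite ea eb (sum_pt l' lb') => /eqP.
rewrite -subr_eq0 -scalerBl scaler_eq0 subr_eq0 (inj_eq invr_inj).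
by rewrite (inj_eq (addrI 1)) eqr_opp addr_eq0 => /orP[/eqP|/eqP/xNy].
Qed.

End RealHilbert.

(** * The projection formulas *)

Theorem theorem5p2 (R : realType) (X : completeNormedModType R)
    (dot : {dot X for idfun}) (dot_norm : induces_norm dot)
    (gamma : R) (gamma_lt0 : gamma < 0) (x0 y0 : X) :
  [/\ (* (i) *)
      x0 <> y0 -> x0 <> - y0 ->
      let p : R := - 2 * dot x0 y0 in
      let q : R := `|x0| ^+ 2 + `|y0| ^+ 2 in
      exists lambda : R,
        unique (fun l : R => -1 < l < 1 /\ Hfun p q gamma l = 0) lambda /\
        projset (Cset dot gamma) (x0, y0) =
          [set ((1 - lambda ^+ 2)^-1 *: (x0 + lambda *: y0),
                (1 - lambda ^+ 2)^-1 *: (y0 + lambda *: x0))],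
      (* (ii) *)
      x0 = y0 ->
      projset (Cset dot gamma) (x0, x0) =
        [set (2^-1 *: x0 + (Num.sqrt 2)^-1 *: u,
              2^-1 *: x0 - (Num.sqrt 2)^-1 *: u)
        | u in [set u : X | `|u| ^+ 2 = - 2 * gamma + `|x0| ^+ 2 / 2]],
      (* (iii) a) *)
      x0 = - y0 -> 2 * Num.sqrt (- gamma) <= `|x0| ->
      projset (Cset dot gamma) (x0, - x0) =
        [set (2^-1 *: x0 - (Num.sqrt 2)^-1 *: v,
              2^-1 *: (- x0) - (Num.sqrt 2)^-1 *: v)
        | v in [set v : X | `|v| ^+ 2 = `|x0| ^+ 2 / 2 + 2 * gamma]]
    & (* (iii) b) *)
      x0 = - y0 -> 0 < `|x0| < 2 * Num.sqrt (- gamma) ->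
      projset (Cset dot gamma) (x0, - x0) =
        [set Num.sqrt (- gamma) *: (`|x0|^-1 *: x0, `|x0|^-1 *: (- x0))]].
Proof.
split.
- move=> xy xNy p q.
  have [l l1 Hl] := Hfun_root dot_norm gamma xy xNy.
  exists l; split; last exact: projset_Hfun_root.
  by split=> // l' [l1' Hl']; exact: (Hfun_root_unique dot_norm xNy l1 Hl).
- move=> _.
  have -> : - 2 * gamma + `|x0| ^+ 2 / 2 = `|x0| ^+ 2 / 2 - 2 * 1 * gamma by ring.
  have := @projset_diag _ _ _ dot_norm gamma 1 x0 (ltr0_neq0 gamma_lt0) (expr1n _ _).
  rewrite scale1r => ->; last by nra.
  by congr image; apply/funext => u; rewrite scale1r.
- move=> _ far.
  have -> : `|x0| ^+ 2 / 2 + 2 * gamma = `|x0| ^+ 2 / 2 - 2 * -1 * gamma by ring.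
  have e2 : (-1) ^+ 2 = 1 :> R by rewrite sqrrN expr1n.
  have := @projset_diag _ _ _ dot_norm gamma (-1) x0 (ltr0_neq0 gamma_lt0) e2.
  rewrite scaleN1r => ->.
    by congr image; apply/funext => u; rewrite scaleN1r.
  have s2 : Num.sqrt (- gamma) ^+ 2 = - gamma by rewrite sqr_sqrtr //; lra.
  have s0 := sqrtr_ge0 (- gamma).
  by move: (Num.sqrt _) s2 s0 far => s s2 s0 far; nra.
- move=> _; exact: projset_opp_near.
Qed.
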